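(* Let $(!, \delta, \varepsilon, \Delta, \mathsf{e}, \mathsf{m},\mathsf{m}_K)$ be a monoidal coalgebra modality on an additive symmetric monoidal category $(\mathbb{X}, \otimes, K)$. Then there exists a natural transformation $\mathsf{S}_A: !(A) \to !(A)$ such that for each object $A$, $(!(A), \nabla_A, \mathsf{u}_A, \Delta_A, \mathsf{e}_A, \mathsf{S}_A)$ is a cocommutative Hopf monoid if and only if $(\mathbb{X}, \otimes, K)$ is enriched over abelian groups (i.e. has negatives: every map $f$ has an additive inverse $-f$ with $f+(-f)=0$).
   Context: Composition is in diagrammatic order; $\ell,\rho$ are the unitors. An additive symmetric monoidal category is a symmetric monoidal category whose hom-sets are commutative monoids ($+$, $0$), with composition and $\otimes$ preserving sums and zeros in each argument. A monoidal coalgebra modality is a symmetric monoidal comonad $(!,\delta,\varepsilon,\mathsf{m},\mathsf{m}_K)$ ($\mathsf{m}_{A,B}:!(A)\otimes!(B)\to!(A\otimes B)$, $\mathsf{m}_K:K\to!(K)$) with natural cocommutative comonoids $(!(A),\Delta_A,\mathsf{e}_A)$ such that $\delta_A$ is a comonoid morphism and $\Delta,\mathsf{e}$ are monoidal transformations and $!$-coalgebra morphisms. Here $\nabla_A := (\delta_A\otimes\delta_A);\mathsf{m}_{!(A),!(A)};!\big(((\varepsilon_A\otimes\mathsf{e}_A);\rho_A)+((\mathsf{e}_A\otimes\varepsilon_A);\ell_A)\big)$ and $\mathsf{u}_A:=\mathsf{m}_K;!(0_{K,A})$, which make $(!(A),\nabla_A,\mathsf{u}_A,\Delta_A,\mathsf{e}_A)$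 a commutative and cocommutative bimonoid. A Hopf monoid is a bimonoid with antipode $\mathsf{S}$ satisfying $\Delta;(1\otimes\mathsf{S});\nabla=\mathsf{e};\mathsf{u}=\Delta;(\mathsf{S}\otimes1);\nabla$. *)

(* Defs.v *)
(* Plain Rocq world: no category-theory library is installed, so the
   notions of the paper are defined here from scratch.
   Composition is written in diagrammatic order: f ;; g = "first f, then g". *)

Set Implicit Arguments.
Unset Strict Implicit.

Record SMCData := {
  ob : Type;
  hom : ob -> ob -> Type;
  idm : forall A, hom A A;
  comp : forall A B C, hom A B -> hom B C -> hom A C;
  tob : ob -> ob -> ob;
  tm : forall A B C D, hom A B -> hom C D -> hom (tob A C) (tob B D);
  unt : ob;
  asc : forall A B C, hom (tob (tob A B) C) (tob A (tob B C));
  asci : forall A B C, hom (tob A (tob B C)) (tob (tob A B) C);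
  lu : forall A, hom (tob unt A) A;
  lui : forall A, hom A (tob unt A);
  ru : forall A, hom (tob A unt) A;
  rui : forall A, hom A (tob A unt);
  sym : forall A B, hom (tob A B) (tob B A);
  hplus : forall A B, hom A B -> hom A B -> hom A B;
  hzero : forall A B, hom A B
}.

Arguments hom {s} _ _.
Arguments idm {s} A.
Arguments comp {s A B C} _ _.
Arguments tob {s} _ _.
Arguments tm {s A B C D} _ _.
Arguments unt {s}.
Arguments asc {s} A B C.
Arguments asci {s} A B C.
Arguments lu {s} A.
Arguments lui {s} A.
Arguments ru {s} A.
Arguments rui {s} A.
Arguments sym {s} A B.
Arguments hplus {s A B} _ _.
Arguments hzero {s} A B.

Declare Scope smc_scope.
Delimit Scope smc_scope with smc.
Open Scope smc_scope.
Notation "f ;; g" := (comp f g) (at level 50, left associativity) : smc_scope.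
Notation "A ⊗ B" := (tob A B) (at level 40, left associativity) : smc_scope.
Notation "f ⊠ g" := (tm f g) (at level 40, left associativity) : smc_scope.
Notation "f +h g" := (hplus f g) (at level 55, left associativity) : smc_scope.

Definition ichg {X : SMCData} (A B C D : ob X) :
  hom ((A ⊗ B) ⊗ (C ⊗ D)) ((A ⊗ C) ⊗ (B ⊗ D)) :=
  asc A B (C ⊗ D) ;; (idm A ⊠ asci B C D) ;; (idm A ⊠ (sym B C ⊠ idm D))
  ;; (idm A ⊠ asc C B D) ;; asci A C (B ⊗ D).

Record IsAddSMC (X : SMCData) : Prop := {
  comp_assoc : forall (A B C D : ob X) (f : hom A B) (g : hom B C) (h : hom C D),
      (f ;; g) ;; h = f ;; (g ;; h);
  comp_id_l : forall (A B : ob X) (f : hom A B), idm A ;; f = f;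
  comp_id_r : forall (A B : ob X) (f : hom A B), f ;; idm B = f;
  tm_id : forall A B : ob X, idm A ⊠ idm B = idm (A ⊗ B);
  tm_comp : forall (A B C D E F : ob X) (f : hom A B) (g : hom C D)
      (h : hom B E) (k : hom D F), (f ⊠ g) ;; (h ⊠ k) = (f ;; h) ⊠ (g ;; k);
  asc_nat : forall (A B C D E F : ob X) (f : hom A B) (g : hom C D) (h : hom E F),
      ((f ⊠ g) ⊠ h) ;; asc B D F = asc A C E ;; (f ⊠ (g ⊠ h));
  asc_asci : forall A B C : ob X, asc A B C ;; asci A B C = idm _;
  asci_asc : forall A B C : ob X, asci A B C ;; asc A B C = idm _;
  lu_nat : forall (A B : ob X) (f : hom A B), (idm unt ⊠ f) ;; lu B = lu A ;; f;
  lu_lui : forall A : ob X, lu A ;; lui A = idm _;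
  lui_lu : forall A : ob X, lui A ;; lu A = idm _;
  ru_nat : forall (A B : ob X) (f : hom A B), (f ⊠ idm unt) ;; ru B = ru A ;; f;
  ru_rui : forall A : ob X, ru A ;; rui A = idm _;
  rui_ru : forall A : ob X, rui A ;; ru A = idm _;
  sym_nat : forall (A B C D : ob X) (f : hom A B) (g : hom C D),
      (f ⊠ g) ;; sym B D = sym A C ;; (g ⊠ f);
  sym_sym : forall A B : ob X, sym A B ;; sym B A = idm _;
  pentagon : forall A B C D : ob X,
      (asc A B C ⊠ idm D) ;; asc A (B ⊗ C) D ;; (idm A ⊠ asc B C D)
      = asc (A ⊗ B) C D ;; asc A B (C ⊗ D);
  triangle : forall A B : ob X,
      asc A unt B ;; (idm A ⊠ lu B) = ru A ⊠ idm B;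
  hexagon : forall A B C : ob X,
      asc A B C ;; sym A (B ⊗ C) ;; asc B C A
      = (sym A B ⊠ idm C) ;; asc B A C ;; (idm B ⊠ sym A C);
  hplus_assoc : forall (A B : ob X) (f g h : hom A B), (f +h g) +h h = f +h (g +h h);
  hplus_comm : forall (A B : ob X) (f g : hom A B), f +h g = g +h f;
  hplus_0 : forall (A B : ob X) (f : hom A B), f +h hzero A B = f;
  comp_plus_l : forall (A B C : ob X) (f f' : hom A B) (g : hom B C),
      (f +h f') ;; g = (f ;; g) +h (f' ;; g);
  comp_plus_r : forall (A B C : ob X) (f : hom A B) (g g' : hom B C),
      f ;; (g +h g') = (f ;; g) +h (f ;; g');
  comp_zero_l : forall (A B C : ob X) (g : hom B C), hzero A B ;; g = hzero A C;
  comp_zero_r : forall (A B C : ob X) (f : hom A B), f ;; hzero B C = hzero A C;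
  tm_plus_l : forall (A B C D : ob X) (f f' : hom A B) (g : hom C D),
      (f +h f') ⊠ g = (f ⊠ g) +h (f' ⊠ g);
  tm_plus_r : forall (A B C D : ob X) (f : hom A B) (g g' : hom C D),
      f ⊠ (g +h g') = (f ⊠ g) +h (f ⊠ g');
  tm_zero_l : forall (A B C D : ob X) (g : hom C D),
      hzero A B ⊠ g = hzero (A ⊗ C) (B ⊗ D);
  tm_zero_r : forall (A B C D : ob X) (f : hom A B),
      f ⊠ hzero C D = hzero (A ⊗ C) (B ⊗ D)
}.

Definition has_negatives (X : SMCData) : Prop :=
  forall (A B : ob X) (f : hom A B), exists g : hom A B, f +h g = hzero A B.

Record MCMData (X : SMCData) := {
  bo : ob X -> ob X;
  bm : forall A B : ob X, hom A B -> hom (bo A) (bo B);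
  dlt : forall A : ob X, hom (bo A) (bo (bo A));
  eps : forall A : ob X, hom (bo A) A;
  mm : forall A B : ob X, hom (bo A ⊗ bo B) (bo (A ⊗ B));
  mK : hom unt (bo unt);
  cDelta : forall A : ob X, hom (bo A) (bo A ⊗ bo A);
  ce : forall A : ob X, hom (bo A) unt
}.

Arguments bo {X} m A.
Arguments bm {X} m {A B} f.
Arguments dlt {X} m A.
Arguments eps {X} m A.
Arguments mm {X} m A B.
Arguments mK {X} m.
Arguments cDelta {X} m A.
Arguments ce {X} m A.

Record IsMCM (X : SMCData) (M : MCMData X) : Prop := {
  bm_id : forall A : ob X, bm M (idm A) = idm (bo M A);
  bm_comp : forall (A B C : ob X) (f : hom A B) (g : hom B C),
      bm M (f ;; g) = bm M f ;; bm M g;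
  dlt_nat : forall (A B : ob X) (f : hom A B),
      bm M f ;; dlt M B = dlt M A ;; bm M (bm M f);
  eps_nat : forall (A B : ob X) (f : hom A B), bm M f ;; eps M B = eps M A ;; f;
  comonad_assoc : forall A : ob X,
      dlt M A ;; dlt M (bo M A) = dlt M A ;; bm M (dlt M A);
  comonad_unit_l : forall A : ob X, dlt M A ;; eps M (bo M A) = idm _;
  comonad_unit_r : forall A : ob X, dlt M A ;; bm M (eps M A) = idm _;
  mm_nat : forall (A B C D : ob X) (f : hom A B) (g : hom C D),
      (bm M f ⊠ bm M g) ;; mm M B D = mm M A C ;; bm M (f ⊠ g);
  mm_assoc : forall A B C : ob X,
      (mm M A B ⊠ idm (bo M C)) ;; mm M (A ⊗ B) C ;; bm M (asc A B C)
      = asc (bo M A) (bo M B) (bo M C) ;; (idm (bo M A) ⊠ mm M B C) ;; mm M A (B ⊗ C);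
  mm_unit_l : forall A : ob X,
      (mK M ⊠ idm (bo M A)) ;; mm M unt A ;; bm M (lu A) = lu (bo M A);
  mm_unit_r : forall A : ob X,
      (idm (bo M A) ⊠ mK M) ;; mm M A unt ;; bm M (ru A) = ru (bo M A);
  mm_sym : forall A B : ob X,
      mm M A B ;; bm M (sym A B) = sym (bo M A) (bo M B) ;; mm M B A;
  dlt_monoidal : forall A B : ob X,
      mm M A B ;; dlt M (A ⊗ B)
      = (dlt M A ⊠ dlt M B) ;; mm M (bo M A) (bo M B) ;; bm M (mm M A B);
  dlt_monoidal_K : mK M ;; dlt M unt = mK M ;; bm M (mK M);
  eps_monoidal : forall A B : ob X, mm M A B ;; eps M (A ⊗ B) = eps M A ⊠ eps M B;
  eps_monoidal_K : mK M ;; eps M unt = idm unt;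
  cDelta_nat : forall (A B : ob X) (f : hom A B),
      bm M f ;; cDelta M B = cDelta M A ;; (bm M f ⊠ bm M f);
  ce_nat : forall (A B : ob X) (f : hom A B), bm M f ;; ce M B = ce M A;
  cDelta_coassoc : forall A : ob X,
      cDelta M A ;; (cDelta M A ⊠ idm (bo M A)) ;; asc _ _ _
      = cDelta M A ;; (idm (bo M A) ⊠ cDelta M A);
  cDelta_counit_l : forall A : ob X,
      cDelta M A ;; (ce M A ⊠ idm (bo M A)) ;; lu _ = idm _;
  cDelta_counit_r : forall A : ob X,
      cDelta M A ;; (idm (bo M A) ⊠ ce M A) ;; ru _ = idm _;
  cDelta_cocomm : forall A : ob X, cDelta M A ;; sym _ _ = cDelta M A;
  dlt_cDelta : forall A : ob X,
      dlt M A ;; cDelta M (bo M A) = cDelta M A ;; (dlt M A ⊠ dlt M A);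
  dlt_ce : forall A : ob X, dlt M A ;; ce M (bo M A) = ce M A;
  cDelta_monoidal : forall A B : ob X,
      mm M A B ;; cDelta M (A ⊗ B)
      = (cDelta M A ⊠ cDelta M B) ;; ichg _ _ _ _ ;; (mm M A B ⊠ mm M A B);
  cDelta_monoidal_K : mK M ;; cDelta M unt = lui unt ;; (mK M ⊠ mK M);
  ce_monoidal : forall A B : ob X,
      mm M A B ;; ce M (A ⊗ B) = (ce M A ⊠ ce M B) ;; lu unt;
  ce_monoidal_K : mK M ;; ce M unt = idm unt;
  cDelta_coalg : forall A : ob X,
      dlt M A ;; bm M (cDelta M A)
      = cDelta M A ;; (dlt M A ⊠ dlt M A) ;; mm M (bo M A) (bo M A);
  ce_coalg : forall A : ob X, dlt M A ;; bm M (ce M A) = ce M A ;; mK M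
}.

Definition nabla {X : SMCData} (M : MCMData X) (A : ob X) :
  hom (bo M A ⊗ bo M A) (bo M A) :=
  (dlt M A ⊠ dlt M A) ;; mm M (bo M A) (bo M A)
  ;; bm M (((eps M A ⊠ ce M A) ;; ru A) +h ((ce M A ⊠ eps M A) ;; lu A)).

Definition uunit {X : SMCData} (M : MCMData X) (A : ob X) : hom unt (bo M A) :=
  mK M ;; bm M (hzero unt A).

Record IsCocommHopfMonoid (X : SMCData) (H : ob X) (nab : hom (H ⊗ H) H)
    (u : hom unt H) (Del : hom H (H ⊗ H)) (e : hom H unt) (S : hom H H) : Prop := {
  hm_assoc : (nab ⊠ idm H) ;; nab = asc H H H ;; (idm H ⊠ nab) ;; nab;
  hm_unit_l : (u ⊠ idm H) ;; nab = lu H;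
  hm_unit_r : (idm H ⊠ u) ;; nab = ru H;
  hm_coassoc : Del ;; (Del ⊠ idm H) ;; asc H H H = Del ;; (idm H ⊠ Del);
  hm_counit_l : Del ;; (e ⊠ idm H) ;; lu H = idm H;
  hm_counit_r : Del ;; (idm H ⊠ e) ;; ru H = idm H;
  hm_bi_mult : nab ;; Del = (Del ⊠ Del) ;; ichg H H H H ;; (nab ⊠ nab);
  hm_bi_unit : u ;; Del = lui unt ;; (u ⊠ u);
  hm_bi_counit : nab ;; e = (e ⊠ e) ;; lu unt;
  hm_bi_unit_counit : u ;; e = idm unt;
  hm_antipode_r : Del ;; (idm H ⊠ S) ;; nab = e ;; u;
  hm_antipode_l : Del ;; (S ⊠ idm H) ;; nab = e ;; u;
  hm_cocomm : Del ;; sym H H = Del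
}.

(* Main.v *)
(* Call p : Y -> !C a coalgebra map over g : Y -> !Y when p ;; δ = g ;; !p.
   Since δ ;; !ε = 1, such a p equals g ;; !(p ;; ε), so it is determined by its
   linear part p ;; ε.  The maps ∇, u, !f, e ;; u and Δ ;; (!f ⊗ !g) ;; ∇ are all
   coalgebra maps, and ∇ ;; ε = (ε ⊗ e) ;; ρ + (e ⊗ ε) ;; λ; comparing linear parts
   gives the bimonoid laws, Δ ;; (!f ⊗ !g) ;; ∇ = !(f + g) and !0 = e ;; u.  Hence a
   negative n of 1_A yields the antipode !(n), natural because negatives are unique.
   Conversely, precomposing the antipode equation of !K with m_K and postcomposing
   with e, resp. ε, shows that m_K ;; S ;; ε is a negative of 1_K; tensoring with
   this scalar -1 negates every map. *)

From Stdlib Require Import ClassicalEpsilon.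
Require Import Defs.

Section AdditiveSMC.
Context {X : SMCData} (HX : IsAddSMC X).

Lemma compA {A B C D : ob X} (f : hom A B) (g : hom B C) (h : hom C D) :
  f ;; g ;; h = f ;; (g ;; h).
Proof. apply (comp_assoc HX). Qed.

Lemma comp1f {A B : ob X} (f : hom A B) : idm A ;; f = f.
Proof. apply (comp_id_l HX). Qed.

Lemma compf1 {A B : ob X} (f : hom A B) : f ;; idm B = f.
Proof. apply (comp_id_r HX). Qed.

Lemma tm11 (A B : ob X) : idm A ⊠ idm B = idm (A ⊗ B).
Proof. apply (tm_id HX). Qed.

Lemma tm_compE {A B C D E F : ob X} (f : hom A B) (g : hom C D) (h : hom B E) (k : hom D F) :
  (f ⊠ g) ;; (h ⊠ k) = (f ;; h) ⊠ (g ;; k).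
Proof. apply (tm_comp HX). Qed.

(* Composites are kept right-associated.  [rw H] instantiates the binders of H
   with evars, right-associates it and rewrites with it; a left-hand side
   a ;; b or a ;; (b ;; c) that only occurs at the head of a longer chain
   a ;; (b ;; k) or a ;; (b ;; (c ;; k)) is matched through [chain2]/[chain3]. *)
Lemma chain2 {A B C D : ob X} {a : hom A B} {b : hom B C} {r : hom A C} :
  a ;; b = r -> forall k : hom C D, a ;; (b ;; k) = r ;; k.
Proof. intros H k. rewrite <- compA, H. reflexivity. Qed.

Lemma chain3 {A B C D E : ob X} {a : hom A B} {b : hom B C} {c : hom C D} {r : hom A D} :
  a ;; (b ;; c) = r -> forall k : hom D E, a ;; (b ;; (c ;; k)) = r ;; k.
Proof. intros H k. rewrite <- H, !compA. reflexivity. Qed.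

Ltac open_term H :=
  match type of H with
  | forall _ : _, _ => let h := open_constr:(H _) in open_term h
  | _ => constr:(H)
  end.

Ltac rewrite_in_chain E :=
  first
    [ rewrite E
    | match type of E with
      | _ ;; (_ ;; _) = _ => rewrite (chain3 E)
      | _ ;; _ = _ => rewrite (chain2 E)
      end ];
  repeat rewrite compA.

Ltac rw H :=
  let h := open_term H in
  let E := fresh "E" in
  epose proof h as E; repeat rewrite compA in E; rewrite_in_chain E; clear E.

Ltac rwr H :=
  let h := open_term H in
  let E := fresh "E" in
  epose proof (eq_sym h) as E; repeat rewrite compA in E; rewrite_in_chain E; clear E.

Lemma tm_comp_r {A B C D E : ob X} (f : hom A B) (x : hom C D) (y : hom D E) :
  f ⊠ (x ;; y) = (f ⊠ x) ;; (idm B ⊠ y).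
Proof. rewrite tm_compE, compf1. reflexivity. Qed.

Lemma tm_comp_l {A B C D E : ob X} (f : hom A B) (x : hom C D) (y : hom D E) :
  (x ;; y) ⊠ f = (x ⊠ f) ;; (y ⊠ idm B).
Proof. rewrite tm_compE, compf1. reflexivity. Qed.

Lemma split_mono_cancel {A B C : ob X} {i : hom B C} {j : hom C B} :
  i ;; j = idm B -> forall f g : hom A B, f ;; i = g ;; i -> f = g.
Proof.
  intros Hij f g E. rewrite <- (compf1 f), <- (compf1 g), <- Hij, <- !compA, E.
  reflexivity.
Qed.

Lemma split_epi_cancel {A B C : ob X} {i : hom A B} {j : hom B A} :
  j ;; i = idm B -> forall f g : hom B C, i ;; f = i ;; g -> f = g.
Proof.
  intros Hji f g E. rewrite <- (comp1f f), <- (comp1f g), <- Hji, !compA, E.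
  reflexivity.
Qed.

Lemma tm_unit_r_inj {A B : ob X} (f g : hom A B) : f ⊠ idm unt = g ⊠ idm unt -> f = g.
Proof.
  intro E. apply (split_epi_cancel (rui_ru HX A)).
  rewrite <- !(ru_nat HX), E. reflexivity.
Qed.

Lemma tm_unit_l_inj {A B : ob X} (f g : hom A B) : idm unt ⊠ f = idm unt ⊠ g -> f = g.
Proof.
  intro E. apply (split_epi_cancel (lui_lu HX A)).
  rewrite <- !(lu_nat HX), E. reflexivity.
Qed.

Lemma asci_nat {A B C D E F : ob X} (f : hom A B) (g : hom C D) (h : hom E F) :
  (f ⊠ (g ⊠ h)) ;; asci B D F = asci A C E ;; ((f ⊠ g) ⊠ h).
Proof.
  apply (split_epi_cancel (asci_asc HX A C E)).
  rewrite <- compA, <- (asc_nat HX), compA, (asc_asci HX), compf1,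
    <- compA, (asc_asci HX), comp1f.
  reflexivity.
Qed.

Lemma asc_ru (A B : ob X) : asc A B unt ;; (idm A ⊠ ru B) = ru (A ⊗ B).
Proof.
  apply tm_unit_r_inj. apply (split_mono_cancel (asc_asci HX A B unt)).
  rewrite tm_comp_l, ?compA. rw (asc_nat HX). rewrite <- (triangle HX B unt).
  rewrite (tm_comp_r (idm _)). rw (pentagon HX). rwr (asc_nat HX). rewrite tm11. rw (triangle HX).
  reflexivity.
Qed.

Lemma asc_lu (A B : ob X) : asc unt A B ;; lu (A ⊗ B) = lu A ⊠ idm B.
Proof.
  apply tm_unit_l_inj.
  apply (split_epi_cancel (i := (asc unt unt A ⊠ idm B) ;; asc unt (unt ⊗ A) B)
                          (j := asci unt (unt ⊗ A) B ;; (asci unt unt A ⊠ idm B))).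
  { rewrite ?compA. rw @tm_compE. rewrite (asci_asc HX), comp1f, tm11, comp1f, (asci_asc HX).
    reflexivity. }
  rewrite ?compA, (tm_comp_r (idm _)).
  rw (pentagon HX). rw (triangle HX). rewrite <- (tm11 A B). rwr (asc_nat HX).
  rwr (asc_nat HX). rw @tm_compE. rewrite (triangle HX), comp1f. reflexivity.
Qed.

Lemma lu_ru_unit : lu (@unt X) = ru unt.
Proof.
  apply tm_unit_r_inj. apply (split_mono_cancel (lu_lui HX unt)).
  rewrite <- (triangle HX unt unt), ?compA. rw (lu_nat HX). rw asc_lu. reflexivity.
Qed.

Lemma tm_square_r {A B C D E F : ob X} (a : hom A B) {x : hom C D} {y : hom D E}
    {y' : hom C F} {x' : hom F E} :
  x ;; y = y' ;; x' -> (a ⊠ x) ;; (idm B ⊠ y) = (idm A ⊠ y') ;; (a ⊠ x').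
Proof. intro H. rewrite !tm_compE, comp1f, compf1, H. reflexivity. Qed.

Lemma ichg_nat {A1 A2 A3 A4 B1 B2 B3 B4 : ob X}
    (a : hom A1 B1) (b : hom A2 B2) (c : hom A3 B3) (d : hom A4 B4) :
  ((a ⊠ b) ⊠ (c ⊠ d)) ;; ichg B1 B2 B3 B4 = ichg A1 A2 A3 A4 ;; ((a ⊠ c) ⊠ (b ⊠ d)).
Proof.
  assert (Hsym : ((b ⊠ c) ⊠ d) ;; (sym B2 B3 ⊠ idm B4)
                 = (sym A2 A3 ⊠ idm A4) ;; ((c ⊠ b) ⊠ d)).
  { rewrite !tm_compE, comp1f, compf1, (sym_nat HX). reflexivity. }
  unfold ichg. rewrite ?compA. rw (asc_nat HX).
  rw (tm_square_r a (asci_nat b c d)).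
  rw (tm_square_r a Hsym).
  rw (tm_square_r a (asc_nat HX c b d)).
  rw @asci_nat. reflexivity.
Qed.

Lemma plusA {A B : ob X} (f g h : hom A B) : (f +h g) +h h = f +h (g +h h).
Proof. apply (hplus_assoc HX). Qed.

Lemma plusC {A B : ob X} (f g : hom A B) : f +h g = g +h f.
Proof. apply (hplus_comm HX). Qed.

Lemma plush0 {A B : ob X} (f : hom A B) : f +h hzero A B = f.
Proof. apply (hplus_0 HX). Qed.

Lemma plus0h {A B : ob X} (f : hom A B) : hzero A B +h f = f.
Proof. rewrite plusC. apply plush0. Qed.

Lemma compDl {A B C : ob X} (f f' : hom A B) (g : hom B C) :
  (f +h f') ;; g = (f ;; g) +h (f' ;; g).
Proof. apply (comp_plus_l HX). Qed.

Lemma compDr {A B C : ob X} (f : hom A B) (g g' : hom B C) :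
  f ;; (g +h g') = (f ;; g) +h (f ;; g').
Proof. apply (comp_plus_r HX). Qed.

Lemma comp0f {A B C : ob X} (g : hom B C) : hzero A B ;; g = hzero A C.
Proof. apply (comp_zero_l HX). Qed.

Lemma compf0 {A B C : ob X} (f : hom A B) : f ;; hzero B C = hzero A C.
Proof. apply (comp_zero_r HX). Qed.

Lemma tmDl {A B C D : ob X} (f f' : hom A B) (g : hom C D) :
  (f +h f') ⊠ g = (f ⊠ g) +h (f' ⊠ g).
Proof. apply (tm_plus_l HX). Qed.

Lemma tmDr {A B C D : ob X} (f : hom A B) (g g' : hom C D) :
  f ⊠ (g +h g') = (f ⊠ g) +h (f ⊠ g').
Proof. apply (tm_plus_r HX). Qed.

Lemma tm0f {A B C D : ob X} (g : hom C D) : hzero A B ⊠ g = hzero (A ⊗ C) (B ⊗ D).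
Proof. apply (tm_zero_l HX). Qed.

Lemma tmf0 {A B C D : ob X} (f : hom A B) : f ⊠ hzero C D = hzero (A ⊗ C) (B ⊗ D).
Proof. apply (tm_zero_r HX). Qed.

Lemma plus_comp_idr {A B : ob X} (f : hom A B) (n : hom B B) :
  f +h (f ;; n) = f ;; (idm B +h n).
Proof. rewrite compDr, compf1. reflexivity. Qed.

Lemma neg_unique {A B : ob X} (f x y : hom A B) :
  f +h x = hzero A B -> f +h y = hzero A B -> x = y.
Proof.
  intros Hx Hy. rewrite <- (plush0 x), <- Hy, <- plusA, (plusC x f), Hx, plus0h.
  reflexivity.
Qed.

Lemma neg_natural {A B : ob X} (f : hom A B) (nA : hom A A) (nB : hom B B) :
  idm A +h nA = hzero A A -> idm B +h nB = hzero B B -> f ;; nB = nA ;; f.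
Proof.
  intros HA HB. apply (neg_unique f).
  - rewrite plus_comp_idr, HB, compf0. reflexivity.
  - rewrite <- (comp1f f) at 1. rewrite <- compDl, HA, comp0f. reflexivity.
Qed.

Lemma has_negatives_of_unit (n : hom (@unt X) unt) :
  idm unt +h n = hzero unt unt -> has_negatives X.
Proof.
  intros Hn A B f. exists (rui A ;; ((f ⊠ n) ;; ru B)).
  assert (Ef : f = rui A ;; ((f ⊠ idm unt) ;; ru B)).
  { rewrite (ru_nat HX), <- compA, (rui_ru HX), comp1f. reflexivity. }
  rewrite Ef at 1.
  rewrite <- compDr, <- compDl, <- tmDr, Hn, tmf0, comp0f, compf0. reflexivity.
Qed.

Lemma ru_tm {A B C : ob X} (f : hom A B) (g : hom C unt) :
  (f ⊠ g) ;; ru B = (idm A ⊠ g) ;; (ru A ;; f).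
Proof. rewrite <- (ru_nat HX), <- compA, tm_compE, comp1f, compf1. reflexivity. Qed.

Lemma lu_tm {A B C : ob X} (f : hom A B) (g : hom C unt) :
  (g ⊠ f) ;; lu B = (g ⊠ idm A) ;; (lu A ;; f).
Proof. rewrite <- (lu_nat HX), <- compA, tm_compE, comp1f, compf1. reflexivity. Qed.

Lemma ru_tm_ru {P Q R S : ob X} (x : hom P Q) (y : hom R unt) (z : hom S unt) :
  ((x ⊠ y) ;; ru Q) ⊠ z ;; ru Q = asc P R S ;; (x ⊠ ((y ⊠ z) ;; lu unt) ;; ru Q).
Proof. rewrite tm_comp_l, tm_comp_r, ?compA. rwr (asc_nat HX). rw (triangle HX). reflexivity. Qed.

Lemma lu_tm_ru {P Q R S : ob X} (x : hom P Q) (y : hom R unt) (z : hom S unt) :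
  ((y ⊠ x) ;; lu Q) ⊠ z ;; ru Q = asc R P S ;; (y ⊠ ((x ⊠ z) ;; ru Q) ;; lu Q).
Proof.
  rewrite tm_comp_l, tm_comp_r, ?compA. rwr (asc_nat HX). rw asc_ru. rwr (ru_nat HX).
  reflexivity.
Qed.

Lemma lu_tm_lu {P Q R S : ob X} (x : hom P Q) (y : hom R unt) (z : hom S unt) :
  ((y ⊠ z) ;; lu unt) ⊠ x ;; lu Q = asc R S P ;; (y ⊠ ((z ⊠ x) ;; lu Q) ;; lu Q).
Proof.
  rewrite tm_comp_l, tm_comp_r, ?compA. rwr (asc_nat HX). rw (triangle HX).
  rewrite lu_ru_unit. reflexivity.
Qed.

Section Modality.
Context {M : MCMData X} (HM : IsMCM M).

Notation "! A" := (bo M A) (at level 1, format "! A") : smc_scope.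

Definition coalg_map {Y C : ob X} (g : hom Y (!Y)) (p : hom Y (!C)) : Prop :=
  p ;; dlt M C = g ;; bm M p.

Lemma coalg_map_eq {Y C : ob X} (g : hom Y (!Y)) (p q : hom Y (!C)) :
  coalg_map g p -> coalg_map g q -> p ;; eps M C = q ;; eps M C -> p = q.
Proof.
  unfold coalg_map. intros Hp Hq He.
  rewrite <- (compf1 p), <- (compf1 q), <- (comonad_unit_r HM C), <- !compA, Hp, Hq,
    !compA, <- !(bm_comp HM), He.
  reflexivity.
Qed.

Lemma coalg_map_bm {Y C : ob X} (g : hom Y (!Y)) (k : hom Y C) :
  g ;; dlt M Y = g ;; bm M g -> coalg_map g (g ;; bm M k).
Proof.
  unfold coalg_map. intro Hg. rewrite ?compA. rw (dlt_nat HM). rw Hg.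
  rewrite !(bm_comp HM). reflexivity.
Qed.

Definition tensor_coalg (A B : ob X) : hom (!A ⊗ !B) (!(!A ⊗ !B)) :=
  (dlt M A ⊠ dlt M B) ;; mm M (!A) (!B).

Lemma tensor_coalg_coassoc (A B : ob X) :
  tensor_coalg A B ;; dlt M _ = tensor_coalg A B ;; bm M (tensor_coalg A B).
Proof.
  unfold tensor_coalg. rewrite (bm_comp HM), ?compA. rw (dlt_monoidal HM). rw @tm_compE.
  rewrite !(comonad_assoc HM). rwr @tm_compE. rw (mm_nat HM). reflexivity.
Qed.

Definition nabla_base (A : ob X) : hom (!A ⊗ !A) A :=
  ((eps M A ⊠ ce M A) ;; ru A) +h ((ce M A ⊠ eps M A) ;; lu A).

Lemma nablaE (A : ob X) : nabla M A = tensor_coalg A A ;; bm M (nabla_base A).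
Proof. reflexivity. Qed.

Lemma nabla_dlt (A : ob X) : nabla M A ;; dlt M A = tensor_coalg A A ;; bm M (nabla M A).
Proof. rewrite nablaE. apply coalg_map_bm, tensor_coalg_coassoc. Qed.

Lemma nabla_eps (A : ob X) : nabla M A ;; eps M A = nabla_base A.
Proof.
  rewrite nablaE. unfold tensor_coalg. rewrite ?compA. rw (eps_nat HM).
  rw (eps_monoidal HM). rw @tm_compE. rewrite !(comonad_unit_l HM), tm11, comp1f.
  reflexivity.
Qed.

Lemma nabla_ce (A : ob X) : nabla M A ;; ce M A = (ce M A ⊠ ce M A) ;; lu unt.
Proof.
  rewrite nablaE. unfold tensor_coalg. rewrite ?compA, (ce_nat HM). rw (ce_monoidal HM).
  rw @tm_compE. rewrite !(dlt_ce HM). reflexivity.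
Qed.

Lemma uunit_dlt (A : ob X) : uunit M A ;; dlt M A = mK M ;; bm M (uunit M A).
Proof.
  unfold uunit. rewrite ?compA. rw (dlt_nat HM). rw (dlt_monoidal_K HM).
  rewrite (bm_comp HM). reflexivity.
Qed.

Lemma uunit_eps (A : ob X) : uunit M A ;; eps M A = hzero unt A.
Proof. unfold uunit. rewrite compA, (eps_nat HM), !compf0. reflexivity. Qed.

Lemma uunit_ce (A : ob X) : uunit M A ;; ce M A = idm unt.
Proof. unfold uunit. rewrite compA, (ce_nat HM), (ce_monoidal_K HM). reflexivity. Qed.

Lemma coalg_map_comp {Y Z C : ob X} (g : hom Y (!Y)) (g' : hom Z (!Z)) (h : hom Y Z)
    (q : hom Z (!C)) :
  h ;; g' = g ;; bm M h -> coalg_map g' q -> coalg_map g (h ;; q).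
Proof.
  unfold coalg_map. intros Hh Hq. rewrite compA, Hq, <- compA, Hh, compA, (bm_comp HM).
  reflexivity.
Qed.

Lemma coalg_map_nabla_l {Y A : ob X} (g : hom Y (!Y)) (p : hom Y (!A)) :
  coalg_map g p ->
  coalg_map ((g ⊠ dlt M A) ;; mm M Y (!A)) ((p ⊠ idm (!A)) ;; nabla M A).
Proof.
  unfold coalg_map. intro Hp. rewrite ?compA. rw nabla_dlt. unfold tensor_coalg.
  rewrite ?compA. rw @tm_compE. rewrite Hp, comp1f, tm_comp_l, <- (bm_id HM (!A)), ?compA.
  rw (mm_nat HM). rewrite (bm_comp HM). reflexivity.
Qed.

Lemma coalg_map_nabla_r {Y A : ob X} (g : hom Y (!Y)) (p : hom Y (!A)) :
  coalg_map g p ->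
  coalg_map ((dlt M A ⊠ g) ;; mm M (!A) Y) ((idm (!A) ⊠ p) ;; nabla M A).
Proof.
  unfold coalg_map. intro Hp. rewrite ?compA. rw nabla_dlt. unfold tensor_coalg.
  rewrite ?compA. rw @tm_compE. rewrite Hp, comp1f, tm_comp_r, <- (bm_id HM (!A)), ?compA.
  rw (mm_nat HM). rewrite (bm_comp HM). reflexivity.
Qed.

Lemma nabla_assoc (A : ob X) :
  (nabla M A ⊠ idm (!A)) ;; nabla M A
  = asc (!A) (!A) (!A) ;; (idm (!A) ⊠ nabla M A) ;; nabla M A.
Proof.
  rewrite compA.
  apply (coalg_map_eq ((tensor_coalg A A ⊠ dlt M A) ;; mm M _ _)).
  - apply coalg_map_nabla_l, nabla_dlt.
  - apply (coalg_map_comp _ ((dlt M A ⊠ tensor_coalg A A) ;; mm M _ _)).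
    + unfold tensor_coalg. rewrite (tm_comp_l (dlt M A)), (tm_comp_r (dlt M A)), ?compA.
      rw (mm_assoc HM). rw (asc_nat HX). reflexivity.
    + apply coalg_map_nabla_r, nabla_dlt.
  - rewrite ?compA, nabla_eps. unfold nabla_base. rewrite !compDr. repeat rw @tm_compE.
    rewrite !comp1f, nabla_eps, !nabla_ce. unfold nabla_base.
    rewrite tmDl, tmDr, !compDl, !compDr, ru_tm_ru, lu_tm_ru, lu_tm_lu, plusA.
    reflexivity.
Qed.

Lemma nabla_unit_l (A : ob X) : (uunit M A ⊠ idm (!A)) ;; nabla M A = lu (!A).
Proof.
  apply (coalg_map_eq ((mK M ⊠ dlt M A) ;; mm M _ _)).
  - apply coalg_map_nabla_l, uunit_dlt.
  - unfold coalg_map. rwr (lu_nat HX). rwr (mm_unit_l HM). rw @tm_compE.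
    rewrite comp1f, compf1. reflexivity.
  - rewrite ?compA, nabla_eps. unfold nabla_base. rewrite compDr. repeat rw @tm_compE.
    rewrite uunit_eps, uunit_ce, comp1f, tm0f, comp0f, plus0h, (lu_nat HX), ?comp1f.
    reflexivity.
Qed.

Lemma nabla_unit_r (A : ob X) : (idm (!A) ⊠ uunit M A) ;; nabla M A = ru (!A).
Proof.
  apply (coalg_map_eq ((dlt M A ⊠ mK M) ;; mm M _ _)).
  - apply coalg_map_nabla_r, uunit_dlt.
  - unfold coalg_map. rwr (ru_nat HX). rwr (mm_unit_r HM). rw @tm_compE.
    rewrite comp1f, compf1. reflexivity.
  - rewrite ?compA, nabla_eps. unfold nabla_base. rewrite compDr. repeat rw @tm_compE.
    rewrite uunit_eps, uunit_ce, comp1f, tmf0, comp0f, plush0, (ru_nat HX), ?comp1f.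
    reflexivity.
Qed.

Lemma nabla_cDelta (A : ob X) :
  nabla M A ;; cDelta M A
  = (cDelta M A ⊠ cDelta M A) ;; ichg _ _ _ _ ;; (nabla M A ⊠ nabla M A).
Proof.
  unfold nabla. rewrite ?compA, (cDelta_nat HM). rw (cDelta_monoidal HM).
  rw (tm_compE (dlt M A) (dlt M A) (cDelta M (!A)) (cDelta M (!A))).
  rewrite !(dlt_cDelta HM). rwr @tm_compE. rw @ichg_nat. rw @tm_compE. rw @tm_compE.
  reflexivity.
Qed.

Lemma uunit_cDelta (A : ob X) :
  uunit M A ;; cDelta M A = lui unt ;; (uunit M A ⊠ uunit M A).
Proof.
  unfold uunit. rewrite ?compA, (cDelta_nat HM). rw (cDelta_monoidal_K HM). rw @tm_compE.
  reflexivity.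
Qed.

Lemma cDelta_bm_nabla (A B : ob X) (f g : hom A B) :
  cDelta M A ;; (bm M f ⊠ bm M g) ;; nabla M B = bm M (f +h g).
Proof.
  apply (coalg_map_eq (dlt M A)); unfold coalg_map.
  - rewrite ?compA. rw nabla_dlt. unfold tensor_coalg. rewrite ?compA.
    rw @tm_compE. rewrite !(dlt_nat HM). rwr @tm_compE. rw (mm_nat HM).
    rwr (cDelta_coalg HM). rewrite !(bm_comp HM). reflexivity.
  - apply (dlt_nat HM).
  - rewrite ?compA, nabla_eps, (eps_nat HM). unfold nabla_base.
    rewrite !compDr. repeat rw @tm_compE. rewrite !(ce_nat HM), !(eps_nat HM), ru_tm, lu_tm.
    rewrite ?compA. rw (cDelta_counit_r HM). rw (cDelta_counit_l HM). rewrite !comp1f.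
    reflexivity.
Qed.

Lemma bm_zero (A B : ob X) : bm M (hzero A B) = ce M A ;; uunit M B.
Proof.
  apply (coalg_map_eq (dlt M A)); unfold coalg_map.
  - apply (dlt_nat HM).
  - rewrite compA, uunit_dlt. rwr (ce_coalg HM). rewrite (bm_comp HM). reflexivity.
  - rewrite (eps_nat HM), compA, uunit_eps, !compf0. reflexivity.
Qed.

Lemma antipode_r (A : ob X) (n : hom A A) :
  idm A +h n = hzero A A ->
  cDelta M A ;; (idm (!A) ⊠ bm M n) ;; nabla M A = ce M A ;; uunit M A.
Proof. intro Hn. rewrite <- (bm_id HM), cDelta_bm_nabla, Hn. apply bm_zero. Qed.

Lemma antipode_l (A : ob X) (n : hom A A) :
  idm A +h n = hzero A A ->
  cDelta M A ;; (bm M n ⊠ idm (!A)) ;; nabla M A = ce M A ;; uunit M A.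
Proof. intro Hn. rewrite <- (bm_id HM), cDelta_bm_nabla, plusC, Hn. apply bm_zero. Qed.

Lemma cocomm_hopf_of_neg (A : ob X) (n : hom A A) :
  idm A +h n = hzero A A ->
  IsCocommHopfMonoid (nabla M A) (uunit M A) (cDelta M A) (ce M A) (bm M n).
Proof.
  intro Hn. constructor.
  - apply nabla_assoc.
  - apply nabla_unit_l.
  - apply nabla_unit_r.
  - apply (cDelta_coassoc HM).
  - apply (cDelta_counit_l HM).
  - apply (cDelta_counit_r HM).
  - apply nabla_cDelta.
  - apply uunit_cDelta.
  - apply nabla_ce.
  - apply uunit_ce.
  - apply antipode_r, Hn.
  - apply antipode_l, Hn.
  - apply (cDelta_cocomm HM).
Qed.

Lemma has_negatives_of_antipode (S : hom (!unt) (!unt)) :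
  cDelta M unt ;; (idm _ ⊠ S) ;; nabla M unt = ce M unt ;; uunit M unt ->
  has_negatives X.
Proof.
  intro HS. rewrite !compA in HS.
  assert (Hce : mK M ;; (S ;; ce M unt) = idm unt).
  { transitivity (mK M ;; (cDelta M unt ;; ((idm _ ⊠ S) ;; (nabla M unt ;; ce M unt)))).
    - rewrite nabla_ce. rw (cDelta_monoidal_K HM). repeat rw @tm_compE.
      rewrite !comp1f, (ce_monoidal_K HM). symmetry. rw (lu_nat HX).
      rewrite <- compA, (lui_lu HX), comp1f. reflexivity.
    - rw HS. rewrite uunit_ce, compf1, (ce_monoidal_K HM). reflexivity. }
  apply (has_negatives_of_unit (mK M ;; (S ;; eps M unt))).
  transitivity (mK M ;; (cDelta M unt ;; ((idm _ ⊠ S) ;; (nabla M unt ;; eps M unt)))).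
  - symmetry. rewrite nabla_eps. rw (cDelta_monoidal_K HM). unfold nabla_base.
    rewrite !compDr. repeat rw @tm_compE.
    rewrite !comp1f, (eps_monoidal_K HM), (ce_monoidal_K HM), Hce, tm11, comp1f.
    rw (lu_nat HX). rewrite <- lu_ru_unit, <- compA, (lui_lu HX), comp1f. reflexivity.
  - rw HS. rewrite uunit_eps, !compf0. reflexivity.
Qed.
End Modality.
End AdditiveSMC.

Theorem proposition7p9 (X : SMCData) (HX : IsAddSMC X)
    (M : MCMData X) (HM : IsMCM M) :
  (exists S : forall A : ob X, hom (bo M A) (bo M A),
      (forall (A B : ob X) (f : hom A B), bm M f ;; S B = S A ;; bm M f) /\
      (forall A : ob X,
          IsCocommHopfMonoid (nabla M A) (uunit M A) (cDelta M A) (ce M A) (S A)))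
  <-> has_negatives X.
Proof.
  split.
  - intros [S [_ HS]]. exact (has_negatives_of_antipode HX HM _ (hm_antipode_r (HS unt))).
  - intro Hneg.
    pose (negid := fun A => constructive_indefinite_description _ (Hneg A A (idm A))).
    exists (fun A => bm M (proj1_sig (negid A))). split.
    + intros A B f. rewrite <- !(bm_comp HM).
      f_equal. apply (neg_natural HX); apply proj2_sig.
    + intro A. apply (cocomm_hopf_of_neg HX HM), proj2_sig.
Qed.
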